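(* Let $K$ be an infinite compact Hausdorff space and let $X$ be an infinite-dimensional Banach space. Assume that $f\in S_{C(K,X)}$ does not attain its norm at a cluster point of $K$. Then $f$ is a super AD point of $C(K,X)$ if and only if $f(t_0)$ is a super AD point of $X$ for some isolated point $t_0\in K$.
   Context: Banach spaces are over $\mathbb{K}$ ($\mathbb{R}$ or $\mathbb{C}$); $B_X$, $S_X$ denote the closed unit ball and the unit sphere of $X$; $\mathbb{T}=\{\theta\in\mathbb{K}:|\theta|=1\}$. $C(K,X)$ is the space of continuous functions from $K$ to $X$ with the supremum norm; $f$ attains its norm at $t$ if $\|f(t)\|=\|f\|$. A cluster point of $K$ is a non-isolated point. A super AD point of $X$ is a point $x\in S_X$ such that $\sup_{y\in W}\max_{\theta\in\mathbb{T}}\|x+\theta y\|=2$ for every non-empty relatively weakly open subset $W$ of $B_X$ with $W\cap S_X\neq\emptyset$ (in particular it has norm one). *)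

(* Defs.v *)
From HB Require Import structures.
From mathcomp Require Import all_boot all_order all_algebra.
From mathcomp Require Import all_classical all_reals all_analysis.
From mathcomp Require Import complex.

Set Implicit Arguments.
Unset Strict Implicit.
Unset Printing Implicit Defensive.

Import Order.TTheory GRing.Theory Num.Theory.
Import numFieldNormedType.Exports.

Local Open Scope classical_set_scope.
Local Open Scope ring_scope.

Variant scalar_kind := RealScalars | ComplexScalars.

Definition scalar_field (R : realType) (k : scalar_kind) : numFieldType :=
  match k with RealScalars => R | ComplexScalars => R[i] end.

(* Norms in a [normedModType K] take values in [K], even when [K] is complex.
   There [x <= y] means that [y - x] is a nonnegative real, so the [supremum]
   of a nonempty bounded set of nonnegative reals is its usual one. *)

(* C(T, X). The proof [cT] is carried by the type because the supremum norm,
   and hence the normed-space structure below, needs compactness. *)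
Definition cont_space (T : topologicalType) (cT : compact [set: T])
  (K : numFieldType) (X : normedModType K) : Type := continuousType T X.

Section ContSpace.
Context (T : topologicalType) (cT : compact [set: T]).
Context (K : numFieldType) (X : normedModType K).
Local Notation C := (cont_space cT X).

HB.instance Definition _ := Choice.on C.

Let fn (f : C) : T -> X := (f : continuousType T X).

Let fn_cts (f : C) : continuous (fn f).
Proof. exact: cts_fun. Qed.

Let fn_inj (f g : C) : fn f =1 fn g -> f = g.
Proof. by move=> fg; apply/continuousEP. Qed.

Let zero_cts : continuous (fun _ : T => 0 : X).
Proof. by move=> t; exact: cvg_cst. Qed.

Let opp_cts (f : C) : continuous (fun t => - fn f t).
Proof. by move=> t; apply: cvgN; exact: fn_cts. Qed.

Let add_cts (f g : C) : continuous (fun t => fn f t + fn g t).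
Proof. by move=> t; apply: cvgD; exact: fn_cts. Qed.

Let scale_cts (a : K) (f : C) : continuous (fun t => a *: fn f t).
Proof. by move=> t; apply: cvgZr; exact: fn_cts. Qed.

Definition cont_zero : C := mkcts zero_cts.
Definition cont_opp (f : C) : C := mkcts (@opp_cts f).
Definition cont_add (f g : C) : C := mkcts (@add_cts f g).
Definition cont_scale (a : K) (f : C) : C := mkcts (@scale_cts a f).

Let cont_addA : associative cont_add.
Proof. by move=> f g h; apply: fn_inj => t; exact: addrA. Qed.
Let cont_addC : commutative cont_add.
Proof. by move=> f g; apply: fn_inj => t; exact: addrC. Qed.
Let cont_add0 : left_id cont_zero cont_add.
Proof. by move=> f; apply: fn_inj => t; exact: add0r. Qed.
Let cont_addN : left_inverse cont_zero cont_opp cont_add.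
Proof. by move=> f; apply: fn_inj => t; exact: addNr. Qed.

HB.instance Definition _ := GRing.isZmodule.Build C
  cont_addA cont_addC cont_add0 cont_addN.

Let cont_scaleA a b (f : C) :
  cont_scale a (cont_scale b f) = cont_scale (a * b) f.
Proof. by apply: fn_inj => t; exact: scalerA. Qed.
Let cont_scale1 : left_id 1 cont_scale.
Proof. by move=> f; apply: fn_inj => t; exact: scale1r. Qed.
Let cont_scaleDr : right_distributive cont_scale +%R.
Proof. by move=> a f g; apply: fn_inj => t; exact: scalerDr. Qed.
Let cont_scaleDl (f : C) : {morph cont_scale^~ f : a b / a + b}.
Proof. by move=> a b; apply: fn_inj => t; exact: scalerDl. Qed.

HB.instance Definition _ := GRing.Zmodule_isLmodule.Build K C
  cont_scaleA cont_scale1 cont_scaleDr cont_scaleDl.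

(* The default value [0] is only used when [T] is empty. *)
Definition cont_norm (f : C) : K :=
  supremum 0 [set `|f t| | t in [set: T]].

Lemma cont_norm_attained (f : C) (t0 : T) :
  exists2 t, cont_norm f = `|f t| & forall s, `|f s| <= `|f t|.
Proof.
suff [t tmax] : exists t, forall s, `|f s| <= `|f t|.
  exists t => //; rewrite /cont_norm /supremum; case: ifPn => [/eqP fT0|_].
    suff : [set `|f t| | t in [set: T]] `|f t0| by rewrite fT0.
    by exists t0.
  have sup_t : supremums [set `|f t| | t in [set: T]] `|f t|.
    by split=> [_ [s _ <-]|b]; [exact: tmax|apply; exists t].
  by apply: xget_unique => // y /is_subset1_supremums; exact.
pose A t := [set s | `|f t| <= `|f s|].
have FA : ProperFilter (filter_from [set: T] A).
  apply: filter_from_proper; last by move=> t _; exists t; rewrite /A /=.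
  apply: filter_fromT_filter; first by exists t0.
  move=> s t; have : (`|f s| >=< `|f t|)%O by exact: real_comparable.
  case/orP => st; [exists t|exists s] => u /= le_u; split => //.
    exact: le_trans le_u.
  exact: le_trans le_u.
have [|t [_ tF]] := cT FA; first by exists t0.
exists t => s; rewrite real_leNgt ?normr_real//; apply/negP => ts.
have e0 : 0 < `|f s| - `|f t| by rewrite subr_gt0.
have /cvgrPdist_lt/(_ _ e0) nt := @fn_cts f t.
have [|u [/= su tu]] := tF (A s) _ _ nt; first by exists s.
have := le_lt_trans (lerB_dist (fn f u) (fn f t)) _.
rewrite distrC => /(_ _ tu); rewrite ltrBDr subrK => us.
by have := lt_le_trans us su; rewrite ltxx.
Qed.

Lemma cont_norm_empty (f : C) : (T -> False) -> cont_norm f = 0.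
Proof.
move=> T0; rewrite /cont_norm.
rewrite (_ : [set _ | _ in _] = set0) ?supremum0 //.
by apply/seteqP; split => // x [t _]; case: (T0 t).
Qed.

Lemma cont_norm_ge (f : C) t : `|f t| <= cont_norm f.
Proof. by have [s -> h] := cont_norm_attained f t. Qed.

Let ler_cont_normD (f g : C) :
  cont_norm (f + g) <= cont_norm f + cont_norm g.
Proof.
have [[t _]|/forallNP T0] := pselect (exists _ : T, True); last first.
  by rewrite !cont_norm_empty ?addr0// => t; exact: (T0 t).
have [s -> _] := cont_norm_attained (f + g) t.
have le_s : `|(f + g) s| <= `|f s| + `|g s| := ler_normD (fn f s) (fn g s).
by apply: (le_trans le_s); apply: lerD; exact: cont_norm_ge.
Qed.

Let cont_normZ (a : K) (f : C) : cont_norm (a *: f) = `|a| * cont_norm f.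
Proof.
have [[t _]|/forallNP T0] := pselect (exists _ : T, True); last first.
  by rewrite !cont_norm_empty ?mulr0// => t; exact: (T0 t).
have [s es hs] := cont_norm_attained (a *: f) t.
have [u eu hu] := cont_norm_attained f t.
apply/le_anti/andP; split.
  by rewrite es (normrZ a (fn f s)) ler_wpM2l// eu; exact: hu.
by rewrite eu -(normrZ a (fn f u)); exact: (cont_norm_ge (a *: f)).
Qed.

Let cont_norm0_eq0 (f : C) : cont_norm f = 0 -> f = 0.
Proof.
move=> f0; apply: fn_inj => t; apply/normr0_eq0/le_anti.
by rewrite normr_ge0 andbT -f0; exact: cont_norm_ge.
Qed.

HB.instance Definition _ := Lmodule_isNormed.Build K C
  ler_cont_normD cont_normZ cont_norm0_eq0.

End ContSpace.

Section SuperAD.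
Context (K : numFieldType) (X : normedModType K).

Definition topological_dual := {phi : {linear X -> K^o} | continuous phi}.

HB.instance Definition _ := gen_eqMixin topological_dual.
HB.instance Definition _ := gen_choiceMixin topological_dual.

Definition weak_space := initial_topology
  (fun (x : X) => (fun phi : topological_dual => sval phi x)
                  : {ptws topological_dual -> K^o}).

HB.instance Definition _ := Topological.on weak_space.

Definition unit_ball : set X := [set x | `|x| <= 1].
Definition unit_sphere : set X := [set x | `|x| = 1].
Definition unit_scalars : set K := [set theta | `|theta| = 1].

Definition relatively_weakly_open (W : set X) :=
  exists2 U : set weak_space, open U & W = unit_ball `&` U.

(* The default value [0] is not reached in [super_AD]: over R or C the unit
   scalars are compact, so the continuous function of [theta] that is maximized
   there attains its bound. *)
Definition maximum (A : set K) : K := xget 0 (A `&` ubound A).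

Definition super_AD (x : X) :=
  unit_sphere x /\
  forall W : set X, relatively_weakly_open W -> W !=set0 ->
    W `&` unit_sphere !=set0 ->
    supremum 0 [set maximum [set `|x + theta *: y| | theta in unit_scalars]
               | y in W] = 2.

Definition infinite_dimensional :=
  ~ exists (n : nat) (b : 'I_n -> X),
      forall x, exists c : 'I_n -> K, x = \sum_(i < n) c i *: b i.

End SuperAD.

(* Main.v *)
(** If [t0] is isolated, [x |-> g + (x - g t0) 1_{t0}] is an affine map X -> C(K, X),
    continuous for the weak topologies and preserving the unit balls when
    [|g| <= 1]. It pulls a weakly open neighbourhood of [g] back to a weakly open
    subset of the ball of X, which meets the sphere because X is
    infinite-dimensional; so [super_AD (f t0)] gives [super_AD f].
    Conversely, the closed set A on which [|f| = 1] consists of isolated points,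
    hence is finite by compactness, and [|f| <= m < 1] off A. If no [f t] with
    [t] in A were super AD, witnesses [W_t] of failure would cut out the weakly
    open set of all [g] in the ball with [g t] in [W_t] for [t] in A; it meets
    the sphere, but [|f + theta g|] stays bounded away from 2 on it. *)

Require Import Defs.
From HB Require Import structures.
From mathcomp Require Import all_boot all_order all_algebra.
From mathcomp Require Import all_classical all_reals all_analysis complex.

Set Implicit Arguments.
Unset Strict Implicit.
Unset Printing Implicit Defensive.

Import Order.TTheory GRing.Theory Num.Theory.
Import numFieldNormedType.Exports.
Local Open Scope classical_set_scope.
Local Open Scope ring_scope.

(** * Continuity and compactness facts for the scalar field, real or complex *)

Lemma continuous_modulus (K L : numFieldType) (h : K -> L) :
  (forall eps, 0 < eps -> exists2 d, 0 < d &
     forall x y, `|x - y| < d -> `|h x - h y| < eps) -> continuous h.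
Proof.
move=> hh x; apply/(@cvgrPdist_lt L L K (nbhs x) _ h (h x)) => eps /hh[d d0 hd].
near=> y; apply: hd.
by near: y; exists d.
Unshelve. all: by end_near. Qed.

Lemma real_complex_continuous (R : realType) :
  continuous (fun x : R => x%:C%C : scalar_field R ComplexScalars).
Proof.
apply: continuous_modulus => eps eps0.
(* A positive element of the complex field is real, so its real part serves as a radius in [R]. *)
have eE : eps = (complex.Re eps)%:C%C by rewrite RRe_real// gtr0_real.
exists (complex.Re eps); first by rewrite -ltcR -eE.
move=> x y xy; rewrite -rmorphB normc_def /= expr0n addr0 sqrtr_sqr eE.
by rewrite ltcR.
Qed.

(** Real-variable theorems reach norms with values in [K] by applying [re] first and translating
    back through [e], without a case split on [k]. *)
Lemma scalar_field_real (R : realType) (k : scalar_kind) :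
  exists (e : {rmorphism R -> scalar_field R k}) (re : scalar_field R k -> R),
  [/\ continuous e, continuous re, {mono e : a b / a <= b},
      cancel e re & forall x, x \is Num.real -> e (re x) = x].
Proof.
case: k.
  exists (GRing.RMorphism.clone _ _ (@idfun R) _), idfun; split => //.
  - by apply: continuous_modulus => eps eps0; exists eps.
  - by apply: continuous_modulus => eps eps0; exists eps.
exists (GRing.RMorphism.clone _ _ (real_complex R) _), (@complex.Re R); split.
- exact: real_complex_continuous.
- apply: continuous_modulus => eps eps0; exists eps%:C%C; first by rewrite ltcR.
  move=> x y xy; rewrite -raddfB -ltcR; apply: le_lt_trans xy.
  exact: normc_ge_Re.
- by move=> a b; rewrite lecR.
- by [].
- exact: RRe_real.
Qed.

Lemma unit_scalars_closed (K : numFieldType) : closed (@unit_scalars K).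
Proof.
rewrite (_ : @unit_scalars K = (fun z : K => `|z|) @^-1` [set 1]) //.
apply: preimage_closed; first by move=> z _; exact: (@norm_continuous K K^o).
exact: (accessible_closed_set1 (hausdorff_accessible (@norm_hausdorff _ K^o))).
Qed.

Lemma unit_scalars_compact (R : realType) (k : scalar_kind) :
  compact (@unit_scalars (scalar_field R k)).
Proof.
case: k.
  apply: finite_compact; apply: (@sub_finite_set _ _ [set 1; -1]); last first.
    exact: finite_set2.
  move=> x /eqP; rewrite eqr_norml ler01 andbT.
  by case/orP => /eqP ->; [left|right].
(* For [c] equal to 1 and -1 these are the upper and lower half circles, parametrized by the real
   part; together they cover the unit circle. *)
pose arc (c x : R) : scalar_field R ComplexScalars :=
  x%:C%C + 'i%C * (c * Num.sqrt (1 - x ^+ 2))%:C%C.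
have arc_cpt c : compact (arc c @` `[-1, 1]).
  apply: continuous_compact (@segment_compact _ _ _).
  apply: continuous_subspaceT => x.
  have sq : {for x, continuous (fun y : R => c * Num.sqrt (1 - y ^+ 2) : R)}.
    apply: cvgM; first exact: cvg_cst.
    apply: (continuous_comp (f := fun y : R => 1 - y ^+ 2 : R)).
      by apply: cvgB; [exact: cvg_cst|exact: exprn_continuous].
    exact: sqrt_continuous.
  apply: (@cvgD R[i] R[i]^o); first exact: real_complex_continuous.
  apply: (@cvgM R[i]); first exact: cvg_cst.
  exact: (continuous_comp sq (@real_complex_continuous R _)).
apply: (subclosed_compact (@unit_scalars_closed _)
  (compactU (arc_cpt 1) (arc_cpt (-1)))).
move=> [a b]; rewrite /unit_scalars /= normc_def => -[/= s1].
have ab1 : a ^+ 2 + b ^+ 2 = 1.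
  by rewrite -[LHS]sqr_sqrtr ?s1 ?expr1n// addr_ge0 ?sqr_ge0.
have a1 : `[-1, 1]%classic a.
  rewrite /= in_itv /= -ler_norml -(@expr_le1 _ 2) // real_normK ?num_real//.
  by rewrite -ab1 lerDl sqr_ge0.
have bE : `|b| = Num.sqrt (1 - a ^+ 2).
  by rewrite -ab1 addrAC subrr add0r sqrtr_sqr.
have [b0|b0] := leP 0 b; [left|right]; exists a => //.
  rewrite /arc -bE ger0_norm// mul1r; exact/esym/complexE.
rewrite /arc -bE ltr0_norm// mulN1r opprK; exact/esym/complexE.
Qed.

(** * Norms on compact sets and along rays *)

Section ScalarField.
Context (R : realType) (k : scalar_kind).
Local Notation K := (scalar_field R k).

Lemma compact_norm_max (T : topologicalType) (A : set T)
    (X : normedModType K) (g : T -> X) :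
  compact A -> A !=set0 -> continuous g ->
  exists2 t, A t & forall s, A s -> `|g s| <= `|g t|.
Proof.
move=> cA A0 cg; have [e [re [_ cre le_e _ reK]]] := scalar_field_real R k.
have /(compact_EVT_max A0 cA)[t /set_mem At tmax] :
    {within A, continuous (fun s => re `|g s|)}.
  apply: continuous_subspaceT => s.
  apply: (continuous_comp (f := fun s => `|g s|)); last exact: cre.
  by apply: continuous_comp; [exact: cg|exact: norm_continuous].
exists t => // s /mem_set/tmax; rewrite -le_e !reK //; exact: normr_real.
Qed.

(** The intermediate value theorem applies to the norm along the real ray from [x] in the direction
    [v]: it starts at most 1 and becomes at least 1. *)
Lemma exists_norm1_segment (X : normedModType K) (x v : X) :
  `|x| <= 1 -> v != 0 -> exists c : K, `|x + c *: v| = 1.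
Proof.
move=> x1 v0; have [e [re [ce cre le_e eK reK]]] := scalar_field_real R k.
pose h s := re `|x + e s *: v|.
have eh s : e (h s) = `|x + e s *: v| by rewrite reK ?normr_real.
have nv0 : 0 < `|v| by rewrite normr_gt0.
(* At this parameter the displacement has norm 2, so the sum has norm at least 2 - 1. *)
pose b := re (2 / `|v|).
have eb : e b = 2 / `|v| by rewrite reK ?realM ?realV ?normr_real ?realn.
have b0 : 0 <= b by rewrite -le_e rmorph0 eb divr_ge0.
have ch : {within `[0, b], continuous h}.
  apply: continuous_subspaceT => s.
  apply: (continuous_comp (f := fun s => `|x + e s *: v|)); last exact: cre.
  apply: (continuous_comp (f := fun s => x + e s *: v)); last first.
    exact: norm_continuous.
  apply: cvgD; first exact: cvg_cst.
  by apply: cvgZl; exact: ce.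
have h0 : h 0 <= 1 by rewrite -le_e eh rmorph0 rmorph1 scale0r addr0.
have hb : 1 <= h b.
  rewrite -le_e eh rmorph1 eb.
  have n2 : `|(2 / `|v|) *: v| = 2.
    by rewrite normrZ normrM normfV normr_id divfK ?gt_eqF// normr_nat.
  rewrite [x + _]addrC; apply: le_trans (lerB_normD _ _).
  by rewrite n2 lerBrDr -[2]/(1 + 1) lerD2l.
have [|s _ hs] := IVT b0 ch (v := 1); last by exists (e s); rewrite -eh hs rmorph1.
by rewrite ge_min h0 le_max hb orbT.
Qed.

End ScalarField.

(** * The supremum over rotations in the super AD condition *)

Section ScalarField.
Context (R : realType) (k : scalar_kind).
Local Notation K := (scalar_field R k).

(* The maximum in [super_AD] is attained, so its default value is never reached. *)
Lemma maximum_rotation (X : normedModType K) (x y : X) :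
  exists2 th : K, `|th| = 1 &
    maximum [set `|x + th *: y| | th in @unit_scalars K] = `|x + th *: y| /\
    forall z : K, `|z| = 1 -> `|x + z *: y| <= `|x + th *: y|.
Proof.
have U0 : @unit_scalars K !=set0 by exists 1; rewrite /unit_scalars /= normr1.
have cg : continuous (fun z : K => x + z *: y).
  by move=> z; apply: (@cvgD K X K (nbhs z)); [exact: cvg_cst|exact: scalel_continuous].
have [th th1 thmax] := compact_norm_max (@unit_scalars_compact R k) U0 cg.
exists th => //; split; last exact: thmax.
rewrite /maximum; apply: xget_unique; first split.
- by exists th.
- by move=> _ [z z1 <-]; exact: thmax.
move=> _ [[z z1 <-] ub]; apply/le_anti; rewrite thmax//=.
by apply: ub; exists th.
Qed.

(* As [2 <> 0], the default of [supremum] plays no role here. *)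
Lemma sup_rotation_eq2 (X : normedModType K) (x : X) (W : set X) :
  `|x| = 1 -> W `<=` @unit_ball K X -> W !=set0 ->
  supremum 0 [set maximum [set `|x + th *: y| | th in @unit_scalars K]
             | y in W] = 2 <->
  forall b : K, (forall (y : X) (th : K), W y -> `|th| = 1 ->
    `|x + th *: y| <= b) -> 2 <= b.
Proof.
move=> x1 WB [y0 Wy0]; set E := [set _ | _ in W].
have E0 : E == set0 = false.
  by apply/negbTE/set0P; eexists; exists y0.
split.
  rewrite /supremum E0; case: xgetP => [_ -> [_ ub2] + b hb|_ /esym/eqP].
    move=> E2; move: ub2; rewrite E2; apply => _ [y Wy <-].
    by have [th th1 [-> _]] := maximum_rotation x y; exact: hb.
  by rewrite pnatr_eq0.
move=> h; have sup2 : supremums E 2.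
  split=> [_ [y Wy <-]|b ubE].
    have [th th1 [-> _]] := maximum_rotation x y.
    apply: (le_trans (ler_normD _ _)); rewrite x1 normrZ th1 mul1r.
    by rewrite -[2]/(1 + 1) lerD2l; exact: WB.
  apply: h => y th Wy th1; have [z z1 [zE zmax]] := maximum_rotation x y.
  by apply: (le_trans (zmax _ th1)); rewrite -zE; apply: ubE; exists y.
rewrite /supremum E0; apply: xget_unique => // y.
by move=> /is_subset1_supremums; exact.
Qed.

End ScalarField.

(** * Weak topology and finite families of functionals *)

Section WeakTopology.
Context (K : numFieldType).

Lemma dual_weakly_continuous (X : normedModType K) (phi : topological_dual X) :
  continuous (sval phi : weak_space X -> K^o).
Proof.
pose j (x : weak_space X) : {ptws topological_dual X -> K^o} :=
  fun psi => sval psi x.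
move=> x; apply: (@continuous_comp _ _ _ j (fun g => proj phi g) x).
  exact: initial_continuous.
exact: proj_continuous.
Qed.

(** Composing a functional on [Y] with the affine map gives a functional on [X] plus a constant, and
    the weak topology is initial for the functionals. *)
Lemma weakly_open_preimage (X Y : normedModType K) (L : {linear X -> Y}) (c : Y)
    (U : set (weak_space Y)) :
  continuous L -> open U ->
  open ((fun x => L x + c) @^-1` U : set (weak_space X)).
Proof.
move=> cL oU.
suff : continuous ((fun x => L x + c) : weak_space X -> weak_space Y).
  by move/continuousP; exact.
apply: continuous_comp_initial => x.
apply/(@cvg_sup _ _ _ _ _ (fmap_filter _ (nbhs_filter x))) => phi.
apply: (@continuous_comp_initial _ _ _ _ _ _ x) => {}x.
have cphi : continuous (sval phi \o L).
  by move=> z; apply: continuous_comp; [exact: cL|exact: (svalP phi)].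
pose psi : topological_dual X := exist _ (sval phi \o L : {linear X -> K^o}) cphi.
rewrite [X in continuous_at _ X](_ : _ = fun z => sval psi z + sval phi c); last first.
  by apply/funext => z /=; rewrite linearD.
apply: (@cvgD K K^o _ (nbhs x) (nbhs_filter x)); last exact: cvg_cst.
exact: (@dual_weakly_continuous X psi x).
Qed.

(** A basic weak neighbourhood restricts only finitely many functionals. Asking for equal values
    rather than close ones exhibits a whole affine subspace inside [U]. *)
Lemma weakly_open_finite_dual (X : normedModType K) (U : set (weak_space X)) x :
  open U -> U x -> exists s : seq (topological_dual X),
    forall y, (forall phi, phi \in s -> sval phi y = sval phi x) -> U y.
Proof.
move=> [V oV <-] Vx.
pose B (s : seq (topological_dual X)) : set X :=
  [set y | forall phi, phi \in s -> sval phi y = sval phi x].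
pose F := filter_from [set: seq (topological_dual X)] B.
have FF : Filter F.
  apply: filter_fromT_filter; first by exists [::].
  move=> s t; exists (s ++ t) => y sty; split=> phi phis; apply: sty;
  by rewrite mem_cat phis ?orbT.
pose j (y : X) : {ptws topological_dual X -> K^o} := fun phi => sval phi y.
have jF : j @ F --> j x.
  (* Convergence in the product topology is checked coordinatewise, and the coordinate [phi] is
     constant on [B [:: phi]]. *)
  apply/cvg_sup => phi A [_ [[C oC <-]] Cx sCA].
  exists [:: phi] => // y yx; apply: sCA; rewrite /= /j yx ?mem_head//.
have /jF[s _ sV] : nbhs (j x) V by exact: open_nbhs_nbhs.
by exists s.
Qed.

Lemma finite_dual_kernel (X : normedModType K) (s : seq (topological_dual X)) :
  infinite_dimensional X ->
  exists2 v : X, v != 0 & forall phi, phi \in s -> sval phi v = 0.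
Proof.
move=> dX; apply: contrapT => nv; apply: dX.
have ker0 v : (forall phi, phi \in s -> sval phi v = 0) -> v = 0.
  by move=> sv; apply: contrapT => /eqP v0; apply: nv; exists v.
(* By induction on [s], finitely many vectors span X modulo the joint kernel. *)
suff [b hb] : exists b : seq X, forall x, exists c : nat -> K,
    forall phi, phi \in s -> sval phi (x - \sum_(i < size b) c i *: b`_i) = 0.
  exists (size b), (fun i => b`_i) => x; have [c /ker0/eqP] := hb x.
  by rewrite subr_eq0 => /eqP ->; exists (fun i => c i).
elim: s {nv ker0} => [|phi s [b hb]]; first by exists [::] => x; exists (fun=> 0).
(* If [phi] vanishes on the joint kernel of [s], the list [b] still works; otherwise a vector of
   that kernel on which [phi] is nonzero is added. *)
have [[v vs phiv]|nv] := pselect (exists2 v : X,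
    forall psi, psi \in s -> sval psi v = 0 & sval phi v != 0); last first.
  exists b => x; have [c hc] := hb x; exists c => psi; rewrite inE => /predU1P[->|].
    by apply: contrapT => /eqP phi0; apply: nv; exists (x - \sum_(i < size b) c i *: b`_i).
  exact: hc.
exists (v :: b) => x; have [c hc] := hb x.
pose u := x - \sum_(i < size b) c i *: b`_i.
(* This coefficient makes [phi] vanish on [u - d *: v]; the functionals in [s] already vanish on
   [v]. *)
pose d := sval phi u / sval phi v.
exists (fun i => if i is j.+1 then c j else d) => psi.
rewrite big_ord_recl /= [d *: v + _]addrC opprD addrA -/u linearB linearZ.
rewrite inE => /predU1P[->|psis]; first 
  by rewrite [X in _ - X](_ : _ = sval phi u) ?subrr//; exact: divfK.
by rewrite vs// (_ : _ 0 = 0) ?subr0; [exact: hc|exact: mulr0].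
Qed.

End WeakTopology.

(** Moving from a point of [W] along a common zero of finitely many functionals stays in the weakly
    open set, and this line reaches norm one. *)
Lemma weakly_open_meets_sphere (R : realType) (k : scalar_kind)
    (X : normedModType (scalar_field R k)) (W : set X) :
  infinite_dimensional X -> relatively_weakly_open W -> W !=set0 ->
  W `&` @unit_sphere _ X !=set0.
Proof.
move=> dX [U oU ->] [x [x1 Ux]].
have [s sU] := weakly_open_finite_dual oU Ux.
have [v v0 sv] := finite_dual_kernel s dX.
have [c c1] := exists_norm1_segment x1 v0.
exists (x + c *: v); split=> //; split; first by rewrite /unit_ball /= c1.
by apply: sU => phi phis; rewrite linearD linearZ /= sv// scaler0 addr0.
Qed.

(** * Isolated points, finiteness and patching *)

Section IsolatedPoints.
Context (T : topologicalType).

Lemma nbhs_isolated (t : T) : isolated [set: T] t -> nbhs t [set t].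
Proof. by move=> [_ [V Vt]]; rewrite setIT => <-. Qed.

Lemma open_isolated (A : set T) : A `<=` isolated [set: T] -> open A.
Proof.
move=> isoA; rewrite openE => t At; rewrite /interior.
by apply: filterS (nbhs_isolated (isoA t At)) => _ ->.
Qed.

Lemma compact_isolated_finite (A : set T) :
  compact A -> A `<=` isolated [set: T] -> finite_set A.
Proof.
move=> cA isoA; apply: contrapT => infA.
(* A cluster point of the filter of cofinite subsets of A is not isolated. *)
pose F : set_system T := [set B | finite_set (A `\` B)].
have FF : ProperFilter F.
  apply: Build_ProperFilter_ex.
    move=> B; rewrite /F /= => finB; apply: contrapT => B0; apply: infA.
    apply: sub_finite_set finB => t At; split => // Bt.
    by apply: B0; exists t.
  split.
  - by rewrite /F /mkset setDT; exact: finite_set0.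
  - move=> B C; rewrite /F /mkset [in X in _ -> _ -> X]setDE setCI setIUr.
    by rewrite -!setDE finite_setU.
  - by move=> B C BC; apply: sub_finite_set => t [At nC]; split=> // /BC.
have FA : F A by rewrite /F /= setDv; exact: finite_set0.
have [t [At tF]] := cA F FF FA.
have FAt : F (A `\ t).
  apply: sub_finite_set (finite_set1 t) => s [As].
  by move=> ns; apply: contrapT => st; apply: ns.
by have [u [[_ nu] /nu]] := tF _ _ FAt (nbhs_isolated (isoA t At)).
Qed.

(** [A] is clopen, and each of its points is open, which makes any [g] continuous there. *)
Lemma continuous_isolated_patch (Y : topologicalType) (A : set T)
    (g h : T -> Y) :
  closed A -> A `<=` isolated [set: T] -> continuous h ->
  continuous (fun t => if t \in A then g t else h t).
Proof.
move=> clA isoA ch t B /=; case: ifPn => [/set_mem At|/negP tA] nB.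
  apply: filterS (nbhs_isolated (isoA t At)) => _ ->.
  by rewrite /= mem_set//; exact: nbhs_singleton.
have nA : nbhs t (~` A).
  by apply: open_nbhs_nbhs; split; [exact: closed_openC|move/mem_set].
have hB : nbhs t (h @^-1` B) := ch t B nB.
apply: (@filterS _ (nbhs t) _ _ _ _ (filterI hB nA)) => s [hs nAs] /=.
by rewrite memNset.
Qed.

End IsolatedPoints.

(** Nonnegative elements are comparable although the order of [K] is partial, so finitely many
    values have a maximum. The lower bound [a] lets one further estimate be absorbed. *)
Lemma finite_bound_lt (K : numDomainType) (T : choiceType) (A : set T)
    (b : T -> K) (c a : K) :
  finite_set A -> (forall t, A t -> 0 <= b t < c) -> 0 <= a < c ->
  exists2 B, a <= B < c & forall t, A t -> b t <= B.
Proof.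
move=> /finite_seqP[s ->]; elim: s => [|u s IH] bc /andP[a0 ac].
  by exists a => //; rewrite lexx.
have [|//|B /andP[aB Bc] bB] := IH.
- by move=> t ts; apply: bc; rewrite /= inE; apply/orP; right.
- by rewrite a0.
have /andP[u0 uc] : 0 <= b u < c by apply: bc; rewrite /= inE eqxx.
have B0 : 0 <= B := le_trans a0 aB.
have [uB|Bu] := real_leP (ger0_real u0) (ger0_real B0).
  exists B; first by rewrite aB.
  by move=> t /=; rewrite inE => /predU1P[->//|]; exact: bB.
exists (b u); first by rewrite uc (le_trans aB (ltW Bu)).
move=> t /=; rewrite inE => /predU1P[->//|ts].
exact: le_trans (bB t ts) (ltW Bu).
Qed.

Lemma linear_contraction_continuous (K : numFieldType) (X Y : normedModType K)
    (L : {linear X -> Y}) : (forall x, `|L x| <= `|x|) -> continuous L.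
Proof.
move=> L1 x; apply/cvgrPdist_lt => eps eps0; near=> y.
rewrite -linearB; apply: le_lt_trans (L1 _) _; near: y.
exact: (@cvgr_dist_lt _ _ _ (nbhs x) _ id x cvg_id).
Unshelve. all: by end_near. Qed.

(** * Evaluations and bump functions on the space of continuous maps *)

Section ContSpace.
Context (T : topologicalType) (cT : compact [set: T]).
Context (K : numFieldType) (X : normedModType K).
Local Notation C := (cont_space cT X).

Lemma cont_space_continuous (g : C) : continuous (g : T -> X).
Proof. exact: (@cts_fun _ _ (g : continuousType T X)). Qed.

Lemma cont_norm_le (g : C) (c : K) :
  0 <= c -> (forall t, `|g t| <= c) -> `|g| <= c.
Proof.
move=> c0 gc; have [[t _]|/forallNP T0] := pselect (exists _ : T, True).
  by have [s + _] := cont_norm_attained g t; rewrite -[`|g|]/(cont_norm g) => ->.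
by rewrite -[`|g|]/(cont_norm g) cont_norm_empty// => t; exact: (T0 t).
Qed.

Definition cont_eval (t : T) (g : C) : X := g t.

Lemma cont_eval_is_linear (t : T) : linear (cont_eval t).
Proof. by []. Qed.

HB.instance Definition _ (t : T) :=
  GRing.isLinear.Build K C X *:%R (cont_eval t) (cont_eval_is_linear t).

Lemma cont_eval_continuous (t : T) : continuous (cont_eval t).
Proof.
by apply: linear_contraction_continuous => g; exact: (cont_norm_ge g).
Qed.

Section Bump.
Context (hT : hausdorff_space T) (t0 : T) (iso : isolated [set: T] t0).

(** The singleton of [t0] is closed because [T] is Hausdorff and open because [t0] is isolated. *)
Lemma bump_fun_continuous (x : X) :
  continuous (fun t => if t \in [set t0] then x else 0).
Proof.
apply: continuous_isolated_patch.
- exact/accessible_closed_set1/hausdorff_accessible.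
- by move=> _ ->.
- by move=> t; exact: cvg_cst.
Qed.

Definition bump (x : X) : C := mkcts (@bump_fun_continuous x).

Lemma bump_is_linear : linear bump.
Proof.
move=> a x y; apply/continuousEP => t.
change ((if t \in [set t0] then a *: x + y else 0) =
  a *: (if t \in [set t0] then x else 0) + (if t \in [set t0] then y else 0)).
by case: ifP => // _; rewrite scaler0 addr0.
Qed.

HB.instance Definition _ := GRing.isLinear.Build K X C *:%R bump bump_is_linear.

Lemma bump_at (x : X) : bump x t0 = x.
Proof. by change ((if t0 \in [set t0] then x else 0) = x); rewrite mem_set. Qed.

Lemma bump_off (x : X) t : t <> t0 -> bump x t = 0.
Proof.
move=> tt0; change ((if t \in [set t0] then x else 0) = 0).
by rewrite memNset.
Qed.

Lemma bump_continuous : continuous bump.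
Proof.
apply: linear_contraction_continuous => x; apply: cont_norm_le => // t.
have [->|tt0] := pselect (t = t0); first by rewrite bump_at.
by rewrite bump_off// normr0.
Qed.

End Bump.

End ContSpace.

(** * The two implications *)

Section SuperAD.
Context (R : realType) (k : scalar_kind) (T : topologicalType).
Context (cT : compact [set: T]) (X : normedModType (scalar_field R k)).
Local Notation K := (scalar_field R k).
Local Notation C := (cont_space cT X).

Lemma super_AD_of_isolated (f : C) (t0 : T) :
  hausdorff_space T -> infinite_dimensional X -> `|f| = 1 ->
  isolated [set: T] t0 -> super_AD (f t0) -> super_AD f.
Proof.
move=> hT dX f1 iso [ft1 adt]; split=> // W owW W0 _.
have WB : W `<=` @unit_ball _ C by case: owW => U _ -> g [].
apply/(sup_rotation_eq2 f1 WB W0) => b Wb.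
have [g Wg] := W0; have [U oU WE] := owW.
pose J : {linear X -> C} := @bump T cT K X hT t0 iso.
pose h (x : X) : C := J x + (g - J (g t0)).
have ht0 x : h x t0 = x.
  have -> : h x t0 = J x t0 + (g t0 - J (g t0) t0) by [].
  by rewrite !bump_at subrr addr0.
have hoff x t : t <> t0 -> h x t = g t.
  have -> : h x t = J x t + (g t - J (g t0) t) by [].
  by move=> tt0; rewrite !bump_off// add0r subr0.
pose V : set X := @unit_ball K X `&` h @^-1` U.
have owV : relatively_weakly_open V.
  exists (h @^-1` U) => //; apply: weakly_open_preimage oU.
  exact: bump_continuous.
have g1 : `|g| <= 1 by exact: WB.
have V0 : V !=set0.
  exists (g t0); split; first exact: le_trans (cont_norm_ge g t0) g1.
  by rewrite /= /h addrC subrK; move: Wg; rewrite WE => -[].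
have VB : V `<=` @unit_ball _ X by move=> x [].
have /(sup_rotation_eq2 ft1 VB V0) := adt V owV V0 (weakly_open_meets_sphere dX owV V0).
apply => x th [x1 Ux] th1.
have Wh : W (h x).
  rewrite WE; split => //; apply: cont_norm_le => // t.
  have [->|tt0] := pselect (t = t0); first by rewrite ht0.
  by rewrite hoff//; exact: le_trans (cont_norm_ge g t) g1.
(* The supremum norm dominates the value at [t0], where [h x] equals [x], so a bound over [W] is
   also one over [V]. *)
apply: le_trans (Wb _ _ Wh th1).
have <- : (f + th *: h x) t0 = f t0 + th *: x by rewrite -[in RHS](ht0 x).
exact: cont_norm_ge.
Qed.

Lemma super_AD_at_isolated (f : C) :
  `|f| = 1 -> (forall t : T, ~ isolated [set: T] t -> `|f t| <> `|f|) ->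
  super_AD f -> exists t0 : T, isolated [set: T] t0 /\ super_AD (f t0).
Proof.
move=> f1 hf [_ adf]; apply: contrapT => nad.
pose A := [set t : T | `|f t| = 1].
have isoA : A `<=` isolated [set: T].
  by move=> t At; apply: contrapT => /hf; rewrite f1; exact.
have clA : closed A.
  rewrite (_ : A = (fun t => `|f t|) @^-1` [set 1]) //.
  apply: preimage_closed.
    move=> t _; apply: continuous_comp; first exact: (@cont_space_continuous _ cT _ _ f t).
    exact: norm_continuous.
  exact: (accessible_closed_set1 (hausdorff_accessible (@norm_hausdorff _ K^o))).
have finA : finite_set A.
  exact: compact_isolated_finite (subclosed_compact clA cT _) isoA.
have f_le t : `|f t| <= 1 by rewrite -f1; exact: cont_norm_ge.
have [m /andP[m0 m1] fm] : exists2 m : K, 0 <= m < 1 &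
    forall t, ~ A t -> `|f t| <= m.
  (* If [A] is all of [T], take 0. Otherwise the complement of [A] is compact, [A] being open, and
     the norm of [f] has a maximum there, below 1. *)
  have [B0|/forallNP B0] := pselect ((~` A) !=set0); last first.
    by exists 0; [rewrite lexx ltr01|move=> t nA; case: (B0 t)].
  have cB : compact (~` A).
    by apply: subclosed_compact cT _ => //; apply: open_closedC; exact: open_isolated.
  have [t nAt tmax] := compact_norm_max cB B0 (@cont_space_continuous _ cT _ _ f).
  exists `|f t|; last exact: tmax.
  by rewrite normr_ge0 lt_neqAle f_le andbT; apply/eqP.
(* [p t] packs a weakly open set, a bound below 2 and a point of norm one in that set; off [A] it is
   a dummy triple. *)
have /choice[p hp] : forall t, exists p : set (weak_space X) * K * X, A t ->
    [/\ open p.1.1, `|p.2| = 1, p.1.1 p.2, 0 <= p.1.2 < 2 &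
      forall (y : X) (th : K), `|y| <= 1 -> p.1.1 y -> `|th| = 1 ->
        `|f t + th *: y| <= p.1.2].
  move=> t; have [At|nAt] := pselect (A t); last by exists (set0, 0, 0).
  (* Without such a triple, every bound over every admissible [W] would be at least 2, making [f t]
     super AD. *)
  apply: contrapT => np; apply: nad; exists t; split; first exact: isoA.
  split=> // W owW W0 [x [Wx x1]].
  have WB : W `<=` @unit_ball _ X by case: owW => U _ -> y [].
  apply/(sup_rotation_eq2 At WB W0) => b Wb.
  apply: contrapT => /negP b2; apply: np.
  have [U oU WE] := owW.
  have b0 : 0 <= b by apply: le_trans (Wb x 1 Wx _) => //; exact: normr1.
  exists (U, b, x) => _; split => //=.
  - by move: Wx; rewrite WE => -[].
  - by rewrite b0 real_ltNge// ger0_real.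
  - by move=> y th y1 Uy; apply: Wb; rewrite WE.
have p2 t : A t -> 0 <= (p t).1.2 < 2 by move=> /hp[].
(* The value [1 + m] covers the points off [A], where [f] contributes at most [m] and a function of
   the unit ball at most 1. *)
have [|B /andP[mB B2] bB] := finite_bound_lt (a := 1 + m) finA p2.
  by rewrite addr_ge0// -[2]/(1 + 1) ltrD2l.
pose W : set C := @unit_ball _ C `&`
  \bigcap_(t in A) (cont_eval t @^-1` (p t).1.1).
have owW : relatively_weakly_open W.
  exists (\bigcap_(t in A) (cont_eval t @^-1` (p t).1.1)) => //.
  have [s sA] := (finite_seqP A).1 finA.
  rewrite sA bigcap_seq big_seq; apply: big_ind => [||t ts].
  - exact: openT.
  - by move=> *; exact: openI.
  have At : A t by rewrite sA.
  have [oU _ _ _ _] := hp t At.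
  (* The zero shift puts the evaluation in the affine form of [weakly_open_preimage]. *)
  rewrite (_ : _ @^-1` _ = (fun g : C => cont_eval t g + 0) @^-1` (p t).1.1).
    exact: weakly_open_preimage (@cont_eval_continuous _ _ _ _ t) oU.
  by apply/seteqP; split => g /=; rewrite addr0.
(* The norm of [f] is attained; a point of [A] is what gives [g] norm one below. *)
have [s As] : exists s : T, A s.
  have [[t _]|/forallNP T0] := pselect (exists _ : T, True); last first.
    have := @cont_norm_empty _ cT _ _ f (fun t => T0 t I).
    by rewrite -[cont_norm f]/(`|f|) f1 => /eqP; rewrite oner_eq0.
  by have [s fs _] := cont_norm_attained f t; exists s; rewrite // /A /= -fs.
(* Prescribing the norm-one witnesses on [A] and 0 elsewhere gives a point of [W] on the unit
   sphere. *)
have g_cts : continuous (fun t => if t \in A then (p t).2 else 0).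
  by apply: continuous_isolated_patch => // t; exact: cvg_cst.
pose g : C := mkcts g_cts.
have gA t : A t -> g t = (p t).2.
  by move=> At; change ((if t \in A then (p t).2 else 0) = (p t).2); rewrite mem_set.
have gN t : ~ A t -> g t = 0.
  by move=> nAt; change ((if t \in A then (p t).2 else 0) = 0); rewrite memNset.
have g_le : `|g| <= 1.
  apply: cont_norm_le => // t; have [At|nAt] := pselect (A t).
    by rewrite gA//; have [_ -> _ _ _] := hp t At.
  by rewrite gN// normr0.
have g1 : `|g| = 1.
  apply/le_anti; rewrite g_le /=; apply: le_trans (cont_norm_ge g s).
  by rewrite gA//; have [_ -> _ _ _] := hp s As.
have Wg : W g.
  by split=> // t At; rewrite /= /cont_eval gA//; have [_ _ ? _ _] := hp t At.
have W0 : W !=set0 by exists g.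
have WB : W `<=` @unit_ball _ C by move=> h [].
have WS : W `&` @unit_sphere _ C !=set0 by exists g.
have /(sup_rotation_eq2 f1 WB W0) hB := adf W owW W0 WS.
suff : 2 <= B by rewrite lt_geF.
have B_ge0 : 0 <= B by apply: le_trans mB; rewrite addr_ge0.
apply: hB => h th [h1 Wh] th1; apply: cont_norm_le => // t.
have ht1 : `|h t| <= 1 := le_trans (cont_norm_ge h t) h1.
rewrite -[(f + th *: h) t]/(f t + th *: h t).
have [At|nAt] := pselect (A t).
  have [_ _ _ _ ub] := hp t At.
  by apply: le_trans (bB t At); apply: ub => //; exact: Wh.
apply: le_trans mB; apply: le_trans (ler_normD _ _) _.
by rewrite addrC normrZ th1 mul1r lerD// fm.
Qed.

End SuperAD.

Theorem proposition5p13 (R : realType) (k : scalar_kind)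
    (T : topologicalType) (cT : compact [set: T])
    (hT : hausdorff_space T) (iT : infinite_set [set: T])
    (X : completeNormedModType (scalar_field R k))
    (dX : infinite_dimensional X)
    (f : cont_space cT X) (f1 : `|f| = 1)
    (hf : forall t : T, ~ isolated [set: T] t -> `|f t| <> `|f|) :
  super_AD f <-> exists t0 : T, isolated [set: T] t0 /\ super_AD (f t0).
Proof.
split; first exact: super_AD_at_isolated f1 hf.
by move=> [t0 [iso adt]]; exact: super_AD_of_isolated hT dX f1 iso adt.
Qed.
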